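(* Let $X$ be a nonempty set of non measurable cardinal and let $\mathcal{A}$ be a field of subsets of $X$, with $\mathcal{M}(X,\mathcal{A})$ regarded as a ring under pointwise operations (standing assumption: it is closed under pointwise addition and multiplication). Then $\mathcal{M}(X,\mathcal{A})$ is self-injective if and only if $\mathcal{A}$ is closed under arbitrary unions.
   Context: A field of subsets of a nonempty set $X$ is a nonempty family $\mathcal{A}\subseteq\mathcal{P}(X)$ closed under finite unions and complements in $X$. $\mathcal{M}(X,\mathcal{A})=\{f:X\to\mathbb{R} : f^{-1}(U)\in\mathcal{A}\text{ for every open }U\subseteq\mathbb{R}\}$, with pointwise addition and multiplication. A commutative ring $R$ with identity is self-injective if for every ideal $I$ of $R$, every $R$-module homomorphism $I\to R$ extends to an $R$-module homomorphism $R\to R$. An order ideal of $\mathcal{P}(X)$ is a nonempty family closed under subsets and finite unions; it is proper if it does not contain $X$, and a proper order ideal $P$ is prime if for each $B\subseteq X$ either $B\in P$ or $X\setminus B\in P$. For $x\in X$ put $\mathcal{I}_x=\{A\subseteq X: x\notin A\}$. The set $X$ has a non measurable cardinal if every prime (proper) order ideal of $\mathcal{P}(X)$ that is closed under countable unions is of the form $\mathcal{I}_x$ for some $x\in X$. *)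

(* Defs.v *)
From HB Require Import structures.
From mathcomp Require Import all_boot all_order all_algebra.
From mathcomp Require Import all_classical all_reals all_analysis.
Set Implicit Arguments.
Unset Strict Implicit.
Unset Printing Implicit Defensive.

Import Order.TTheory GRing.Theory Num.Theory.
Import numFieldNormedType.Exports.

Local Open Scope classical_set_scope.
Local Open Scope ring_scope.

(* Ideals of the commutative ring A are the A-submodules of the regular module
   A^o. The unit ideal is included, which the library's idealr excludes. *)
Record ideal_type (A : comPzRingType) (I : submodClosed A^o) : Type :=
  IdealElt { ideal_val : A^o; _ : ideal_val \in I }.

HB.instance Definition _ (A : comPzRingType) (I : submodClosed A^o) :=
  [isSub for @ideal_val A I].
HB.instance Definition _ (A : comPzRingType) (I : submodClosed A^o) :=
  [Choice of ideal_type I by <:].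
HB.instance Definition _ (A : comPzRingType) (I : submodClosed A^o) :=
  [SubChoice_isSubLmodule of ideal_type I by <:].

Definition self_injective (A : comPzRingType) : Prop :=
  forall (I : submodClosed A^o) (f : {linear ideal_type I -> A^o}),
  exists g : {linear A^o -> A^o}, forall x : ideal_type I, g (val x) = f x.

Section SetFamilies.
Context {X : Type}.
Implicit Types F P : set (set X).

Definition field_of_sets F : Prop :=
  [/\ F !=set0, setU_closed F & setC_closed F].

Definition bigcup_closed F : Prop :=
  forall G : set (set X), G `<=` F -> F (\bigcup_(B in G) B).

Definition order_ideal P : Prop :=
  [/\ P !=set0,
      forall B C : set X, B `<=` C -> P C -> P B
    & setU_closed P].

Definition prime_order_ideal P : Prop :=
  [/\ order_ideal P, ~ P setT & forall B : set X, P B \/ P (~` B)].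

Definition countable_union_closed P : Prop :=
  forall B : nat -> set X, (forall n, P (B n)) -> P (\bigcup_n B n).

Definition point_ideal (x : X) : set (set X) := [set B | ~ B x].

Lemma field_of_sets0T F : field_of_sets F -> F set0 /\ F setT.
Proof.
move=> [[B FB] FU FC].
have FT : F setT by rewrite -(setUv B); apply: FU => //; exact: FC.
by split=> //; rewrite -setCT; exact: FC.
Qed.

End SetFamilies.

Definition nonmeasurable_cardinal (X : Type) : Prop :=
  forall P : set (set X), prime_order_ideal P -> countable_union_closed P ->
  exists x : X, P = point_ideal x.

Section FunctionRing.
Context {R : realType} {X : Type}.
Implicit Type F : set (set X).

Definition measurable_fct F : set (X -> R) :=
  [set f | forall U : set R, open U -> F (f @^-1` U)].

Definition measurable_fct_closed F : Prop :=
  (forall f g, measurable_fct F f -> measurable_fct F g ->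
     measurable_fct F (f + g)) /\
  (forall f g, measurable_fct F f -> measurable_fct F g ->
     measurable_fct F (f * g)).

End FunctionRing.
Arguments measurable_fct_closed R {X} F.

Section RingM.
Variables (R : realType) (X : Type) (F : set (set X)).
Hypotheses (FF : field_of_sets F) (FM : measurable_fct_closed R F).

(* The unused hypotheses let Mpred FF FM carry a canonical subring structure:
   without them the family of measurable functions need not be a subring. *)
Definition Mpred of field_of_sets F & measurable_fct_closed R F :
  {pred (X -> R)} := mem (@measurable_fct R X F).

Lemma Mpred_subring : subring_closed (Mpred FF FM).
Proof.
have [F0 FT] := field_of_sets0T FF; have [MD MM] := FM.
have MC (c : R) : measurable_fct F (cst c : X -> R).
  by move=> U _; rewrite preimage_cst; case: ifP.
split=> [|f g /set_mem Mf /set_mem Mg|f g /set_mem Mf /set_mem Mg].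
- by apply/mem_set; exact: MC.
- apply/mem_set; rewrite -mulN1r; apply: MD => //; apply: MM => //.
  exact: (MC (-1)).
- by apply/mem_set; exact: MM.
Qed.

HB.instance Definition _ := GRing.isSubringClosed.Build _ (Mpred FF FM)
  Mpred_subring.

Record Mring : Type := MkMring {
  Mring_fun : X -> R;
  _ : Mring_fun \in Mpred FF FM
}.

HB.instance Definition _ := [isSub for Mring_fun].
HB.instance Definition _ := [Choice of Mring by <:].
HB.instance Definition _ :=
  GRing.SubChoice_isSubComPzRing.Build _ _ Mring (GRing.subringClosedP _).

End RingM.

(* Main.v *)
Require Import Defs.
From HB Require Import structures.
From mathcomp Require Import all_boot all_order all_algebra.
From mathcomp Require Import all_classical all_reals all_analysis.
From mathcomp Require Import lra.

Local Open Scope classical_set_scope.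

(** Write M for the ring of A-measurable functions.

    If A is closed under arbitrary unions, it is also closed under arbitrary
    intersections, so every point lies in a least member of A, its atom. The
    atoms partition X and M consists of the functions constant on each atom: M
    is a product of copies of R, one per atom. A linear map on an ideal I is
    then multiplication, coordinate by coordinate, by the value it takes on the
    indicator of the atom if this indicator lies in I, and by 0 otherwise
    (bigcup_closed_self_injective).

    Conversely, let M be self-injective and let c be any real function on X.
    The functions u in M with c * u in M form an ideal, on which u |-> c * u is
    linear; extending this map to M yields h in M with h * u = c * u throughout
    the ideal. As the ideal contains the indicator of each member of A on which
    c is constant, h agrees with c on all of these members
    (self_injective_glue). Two choices of c are used.
    - For c the indicator of the union of a subfamily G of A, the support of h
      is a member S of A that contains this union and misses every member of A
      disjoint from the union (self_injective_hull). It remains to see that S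
      is no larger than the union.
    - For c equal to n + 1 on the n-th of a sequence of disjoint members of A,
      the open sets around the integers show that the union of the sequence is
      in A, so that A is a sigma-algebra (self_injective_trivIset_closed).

    Given G, take a maximal disjoint family D of nonempty members of A, each
    contained in a member of G. A point p of the hull S of G is not separated
    from D by any member of A. The subfamilies of D from which p is separated
    by a member of A form a prime ideal, thanks to hulls, and this ideal is
    closed under countable unions, as A is a sigma-algebra. Choosing a point in
    each member of D moves this ideal to X, where it must be the ideal of a
    point x; then p lies in the member of D represented by x
    (nonmeasurable_disjoint_closure). Hence p lies in the union of G. *)

(** * Fields of sets and measurable functions *)

Section FieldOfSets.
Set Implicit Arguments.
Unset Strict Implicit.
Context {X : Type} (F : set (set X)) (FF : field_of_sets F).

Lemma field_of_setsC B : F B -> F (~` B).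
Proof. by have [_ _ FC] := FF; exact: FC. Qed.

Lemma field_of_setsI B C : F B -> F C -> F (B `&` C).
Proof.
move=> FB FC; have [_ FU _] := FF.
rewrite -[_ `&` _]setCK setCI; apply: field_of_setsC.
by apply: FU; exact: field_of_setsC.
Qed.

Lemma field_of_setsD B C : F B -> F C -> F (B `\` C).
Proof. by move=> FB FC; apply: field_of_setsI => //; exact: field_of_setsC. Qed.

End FieldOfSets.

Section MeasurableFunctions.
Set Implicit Arguments.
Unset Strict Implicit.
Import numFieldNormedType.Exports.
Local Open Scope ring_scope.
Context {R : realType} {X : Type} (F : set (set X)) (FF : field_of_sets F).

Lemma measurable_fct_cst (k : R) : measurable_fct F (cst k : X -> R).
Proof.
have [F0 FT] := field_of_sets0T FF.
by move=> U _; rewrite preimage_cst; case: ifP.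
Qed.

Lemma measurable_fct_indic B : F B -> measurable_fct F (\1_B : X -> R).
Proof.
move=> FB U _; have [F0 FT] := field_of_sets0T FF.
rewrite preimage_indic; do 2![case: ifP => _] => //.
exact: (field_of_setsC FF).
Qed.

End MeasurableFunctions.

(** * Multipliers from self-injectivity *)

(** Stated at the type A instead of A^o, so that ring lemmas apply after
    rewriting. *)
Lemma ideal_valZ (A : comPzRingType) (I : submodClosed A^o) (a : A)
    (u : ideal_type I) : val (a *: u)%R = (a * (val u : A))%R :> A.
Proof. by []. Qed.

Section Conductor.
Set Implicit Arguments.
Unset Strict Implicit.
Import GRing.Theory.
Local Open Scope ring_scope.
Context {R : realType} {X : Type} {F : set (set X)}.
Context (FF : field_of_sets F) (FM : measurable_fct_closed R F).
Local Notation M := (Mring FF FM).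

Lemma MringP (u : M) : measurable_fct F (val u).
Proof. exact/set_mem/(valP u). Qed.

Lemma MringD (u v : M) : val (u + v) = val u + val v :> (X -> R).
Proof. by []. Qed.

Lemma MringM (u v : M) : val (u * v) = val u * val v :> (X -> R).
Proof. by []. Qed.

Variable c : X -> R.

(** The multiplication by c need not preserve the ring; its domain is the ideal
    of the measurable u for which c * u is measurable again. *)
Definition conductor : {pred M^o} :=
  [pred u : M | `[< measurable_fct F (c * val u) >]].

Lemma conductor_submod : subsemimod_closed conductor.
Proof.
have [MD MM] := FM.
split; first split.
- apply/asboolP; rewrite [val _]/(0 : X -> R) mulr0.
  exact: (measurable_fct_cst FF 0).
- move=> u v /asboolP cu /asboolP cv; apply/asboolP.
  by rewrite [val _]/(val (u : M) + val (v : M)) mulrDr; exact: MD.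
- move=> a u /asboolP cu; apply/asboolP.
  rewrite [val _]/(val (a : M) * val (u : M)) mulrCA.
  by apply: MM => //; exact: MringP.
Qed.

HB.instance Definition _ := GRing.isSubmodClosed.Build M M^o conductor
  conductor_submod.

Lemma conductor_mul_subproof (u : ideal_type conductor) :
  c * val (val u : M) \in Mpred FF FM.
Proof. by have /asboolP cu := valP u; exact/mem_set. Qed.

Definition conductor_mul (u : ideal_type conductor) : M^o :=
  MkMring (conductor_mul_subproof u).

Lemma conductor_mul_linear : linear conductor_mul.
Proof.
move=> a u v; apply: val_inj.
have uvE : val (a *: u + v) = (a : M) * (val u : M) + (val v : M) :> M by [].
rewrite MringD MringM.
have E w : val (conductor_mul w : M) = c * val (val w : M) by [].
by rewrite !E uvE MringD MringM mulrDr mulrCA.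
Qed.

HB.instance Definition _ := GRing.isLinear.Build M (ideal_type conductor) M^o
  _ conductor_mul conductor_mul_linear.

(** An endomorphism g of the regular module is the multiplication by g 1, so
    h = g 1 works for any g extending the multiplication by c. *)
Lemma self_injective_multiplier : self_injective M ->
  exists2 h : X -> R, measurable_fct F h &
    forall u : X -> R, measurable_fct F u -> measurable_fct F (c * u) ->
      h * u = c * u.
Proof.
move=> /(_ conductor conductor_mul)[g gE].
exists (val (g 1 : M)) => [|u Mu Mcu]; first exact: MringP.
pose u' : M := MkMring (mem_set Mu : u \in Mpred FF FM).
have cu' : (u' : M^o) \in conductor by exact/asboolP.
have gu' : g (u' : M^o) = (u' : M) * (g 1 : M).
  have := linearZZ g u' (1 : M^o).
  by rewrite [_ *: (1 : M^o)](mulr1 (u' : M)).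
have := gE (Sub (u' : M^o) cu'); rewrite SubK gu'.
move=> /(congr1 (val : M -> X -> R)); rewrite MringM mulrC => ->.
by [].
Qed.

End Conductor.

(** * Consequences of self-injectivity for the field of sets *)

Section HalfBall.
Import GRing.Theory Num.Theory Order.TTheory numFieldNormedType.Exports.
Local Open Scope ring_scope.

Lemma half_ball_nat_inj {R : realType} (t : R) (m n : nat) :
  ball (m%:R : R) 2^-1 t -> ball (n%:R : R) 2^-1 t -> m = n.
Proof.
wlog : m n / (m < n)%N => [wl tm tn|].
  by have [mn|nm|//] := ltngtP m n; [|symmetry]; exact: wl.
rewrite -(ler_nat R) -natr1 /ball /= !ltr_distl => mn /andP[? ?] /andP[? ?].
by exfalso; lra.
Qed.

End HalfBall.

Section SelfInjective.
Set Implicit Arguments.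
Unset Strict Implicit.
Import Order.TTheory GRing.Theory Num.Theory numFieldNormedType.Exports.
Local Open Scope ring_scope.
Context {R : realType} {X : Type} {F : set (set X)}.
Context (FF : field_of_sets F) (FM : measurable_fct_closed R F).
Hypothesis inj : self_injective (Mring FF FM).

(** If c is constant on B in F, the indicator of B lies in the conductor of c,
    and testing the multiplier on this indicator gives its values on B. *)
Lemma self_injective_glue (c : X -> R) :
  exists2 h : X -> R, measurable_fct F h &
    forall B k, F B -> {in B, forall x, c x = k} -> {in B, forall x, h x = k}.
Proof.
have [h Mh hE] := self_injective_multiplier c inj; exists h => // B k FB cB.
have MB : measurable_fct F (\1_B : X -> R) by exact: measurable_fct_indic.
have cBE : c * \1_B = cst k * \1_B.
  apply/funext => x; rewrite !fctE indicE.
  by have [/cB -> //|_] := boolP (x \in B); rewrite !mulr0.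
have McB : measurable_fct F (c * \1_B).
  by rewrite cBE; apply: FM.2 => //; exact: measurable_fct_cst.
move=> x xB; have := congr1 (fun f => f x) (hE _ MB McB).
by rewrite cBE !fctE indicE xB !mulr1.
Qed.

(** S is the supremum of G in the Boolean algebra F; it may a priori be larger
    than the union of G. *)
Lemma self_injective_hull (G : set (set X)) : G `<=` F ->
  exists2 S, F S & \bigcup_(B in G) B `<=` S /\
    forall C, F C -> (forall B, G B -> B `&` C = set0) -> S `&` C = set0.
Proof.
move=> GF; have [h Mh hE] := self_injective_glue (\1_(\bigcup_(B in G) B)).
exists (h @^-1` [set t | t != 0]); first by apply: Mh; exact: open_neq.
split=> [x [B GB Bx]|C FC GC].
  rewrite /preimage /= (hE B 1) ?oner_eq0 ?inE//; first exact: GF.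
  by move=> y /set_mem By; rewrite indicE mem_set//; exists B.
(* On C the glued function is identically 0, so h vanishes there as well. *)
rewrite -subset0 => x [/= /eqP hx0 Cx]; apply: hx0.
apply: (hE C 0) => //; last exact: mem_set.
move=> y /set_mem Cy; rewrite indicE memNset// => -[B /GC BC By].
by rewrite -[False]/(set0 y) -BC.
Qed.

(** A measurable function h equal to n + 1 on B n makes the union of the B n
    the preimage of one open set, provided that the preimage of a small ball
    around n + 1 is no larger than B n. The excess lies in F and misses every
    B m, so h is 0 there. *)
Lemma self_injective_trivIset_closed : trivIset_closed F.
Proof.
move=> B tB FB.
(* The shift by one keeps the values on the B n away from the default 0. *)
pose c x : R := if pselect (exists n, B n x) is left e
  then (projT1 (cid e)).+1%:R else 0.
have cE n x : B n x -> c x = n.+1%:R.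
  rewrite /c => Bnx; case: pselect => [e|[]]; last by exists n.
  case: cid => m /= Bmx; congr (_.+1%:R).
  by apply: tB => //; exists x.
have [h Mh hE] := self_injective_glue c.
have hB n x : B n x -> h x = n.+1%:R.
  move=> Bnx; apply: (hE (B n)) => //; last exact: mem_set.
  by move=> y /set_mem/cE.
pose U n : set R := ball (n.+1%:R : R) 2^-1.
have UB n : h @^-1` U n = B n.
  apply/seteqP; split=> x; last first.
    by move=> /hB hx; rewrite /preimage /= hx; apply: ballxx; rewrite invr_gt0.
  move=> Ux; apply: contrapT => Bx.
  have : h x = 0.
    apply: (hE (h @^-1` U n `\` B n)); last exact: mem_set.
      apply: (field_of_setsD FF) => //; apply: Mh.
      exact: ball_open.
    move=> y /set_mem[Uy By]; rewrite /c; case: pselect => // -[m Bmy].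
    have mn : m = n.
      have hy : ball (m.+1%:R : R) 2^-1 (h y).
        by rewrite (hB _ _ Bmy); apply: ballxx; rewrite invr_gt0.
      by have [] := half_ball_nat_inj hy Uy.
    by case: By; rewrite -mn.
  move=> hx0; have : ball (n.+1%:R : R) 2^-1 0 by rewrite -hx0.
  rewrite /ball /= subr0 ger0_norm// => n1.
  have : 1 <= n.+1%:R :> R by rewrite ler1n.
  by lra.
have -> : \bigcup_n B n = h @^-1` (\bigcup_n U n).
  by rewrite preimage_bigcup; apply: eq_bigcupr => n _; rewrite UB.
by apply: Mh; apply: bigcup_open => n _; exact: ball_open.
Qed.

Lemma self_injective_bigcap (B : nat -> set X) :
  (forall n, F (B n)) -> F (\bigcap_n B n).
Proof.
move=> FB; have [_ _ Fcompl] := FF; have [_ FT] := field_of_sets0T FF.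
have [] : sigma_algebra setT F.
  apply: dynkin_setI_sigma_algebra; last exact: (field_of_setsI FF).
  by split=> //; exact: self_injective_trivIset_closed.
move=> _ _ Fcup; rewrite -[X in F X]setCK setC_bigcap.
by apply: (field_of_setsC FF); apply: Fcup => n; exact: (field_of_setsC FF).
Qed.

Hypothesis Xnm : nonmeasurable_cardinal X.

(** A point that no member of F separates from the disjoint family D lies in a
    member of D: the subfamilies of D from which p is separated form a prime
    ideal closed under countable unions, which is therefore principal. *)
Lemma nonmeasurable_disjoint_closure (D : set (set X)) (p : X) :
  D `<=` F -> (forall B, D B -> B !=set0) -> trivIset D id ->
  (forall C, F C -> C p -> exists2 B, D B & B `&` C !=set0) ->
  (\bigcup_(B in D) B) p.
Proof.
move=> DF D0 tD Dp; have [_ FT] := field_of_sets0T FF.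
have /boolp.choice[r rD] (B : set X) : exists x, D B -> B x.
  have [/D0[x Bx]|nDB] := pselect (D B); first by exists x.
  by exists p.
(* Subfamilies of D are indexed by sets E of points through the chosen
   representatives r. *)
pose P : set (set X) := [set E | exists C, [/\ F C, C p &
  forall B, D B -> E (r B) -> B `&` C = set0]].
have Pprime : prime_order_ideal P.
  split; first split.
  - by exists set0, setT.
  - move=> E E' EE' [C [FC Cp CE']]; exists C; split=> // B DB /EE'.
    exact: CE'.
  - move=> E E' [C [FC Cp CE]] [C' [FC' Cp' CE']]; exists (C `&` C'); split=> //.
      exact: (field_of_setsI FF).
    move=> B DB [/(CE _ DB) BC|/(CE' _ DB) BC].
      by rewrite setIA BC set0I.
    by rewrite setICA BC setI0.
  - move=> [C [FC Cp CD]]; have [B DB] := Dp C FC Cp.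
    by rewrite CD// => -[].
  - move=> E.
    (* The hull of the subfamily selected by E contains its members and, by
       disjointness, misses the others: it or its complement separates p. *)
    have EF : [set B | D B /\ E (r B)] `<=` F by move=> B [/DF].
    have [S FS [ES Smin]] := self_injective_hull EF.
    have [Sp|nSp] := pselect (S p); [right; exists S|left; exists (~` S)].
      split=> // B DB nEB; rewrite setIC; apply: Smin; first exact: DF.
      move=> B' [DB' EB']; apply: contrapT => /eqP/set0P/(tD _ _ DB' DB) BB'.
      by apply: nEB; rewrite -BB'.
    split=> //; first exact: (field_of_setsC FF).
    move=> B DB EB; apply/disjoints_subset; rewrite setCK.
    by move=> x Bx; apply: ES; exists B.
have Pcountable : countable_union_closed P.
  move=> E /boolp.choice[C CE]; exists (\bigcap_n C n); split.
  - by apply: self_injective_bigcap => n; have [] := CE n.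
  - by move=> n _; have [] := CE n.
  - move=> B DB [n _ EB]; have [_ _ /(_ B DB EB)] := CE n.
    rewrite -!subset0 => BC x [Bx Cx]; apply: BC; split=> //; exact: Cx.
have [x Px] := Xnm Pprime Pcountable; apply: contrapT => Dnp.
(* The singleton of x is outside the principal ideal at x, but if p were in no
   member of D, the complement of the one member represented by x, if any,
   would separate p from it. *)
suff : P [set x] by rewrite Px /point_ideal /=; exact.
have [[B DB rB]|nB] := pselect (exists2 B, D B & r B = x); last first.
  by exists setT; split=> // B DB rB; case: nB; exists B.
exists (~` B); split; first by apply: (field_of_setsC FF); exact: DF.
  by move=> Bp; apply: Dnp; exists B.
move=> B' DB' /= rB'; apply/disjoints_subset; rewrite setCK.
suff -> : B' = B by [].
by apply: tD => //; exists x; split; [rewrite -rB'|rewrite -rB]; exact: rD.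
Qed.

(** The hull of G equals its union: by maximality D meets every member of F
    that meets the union of G, hence no member of F separates a point of the
    hull from D. *)
Lemma self_injective_bigcup_closed : bigcup_closed F.
Proof.
move=> G GF; have [S FS [GS Smin]] := self_injective_hull GF.
suff -> : \bigcup_(B in G) B = S by [].
apply/seteqP; split=> // p Sp.
pose K : set (set X) :=
  [set C | [/\ F C, C !=set0 & exists2 B, G B & C `<=` B]].
have [D [DK tD Dmax]] := ex_maximal_disjoint_subcollection id K.
have meetD C : K C -> exists2 B, D B & B `&` C !=set0.
  move=> KC; apply: contrapT => nDC.
  have DC B : D B -> B `&` C = set0.
    by move=> DB; apply: contrapT => /eqP/set0P BC; apply: nDC; exists B.
  have nC : ~ D C.
    by have [_ C0 _] := KC; move=> DC'; apply: nDC; exists C => //;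
      rewrite setIid.
  apply: (Dmax (C |` D)).
  - by split=> [B DB|]; [right|move=> /(_ C); apply: contra_not nC; apply; left].
  - by move=> B [->|/DK].
  - move=> B B' [->|DB] [->|DB'] //; last exact: tD.
      by rewrite setIC DC// => -[].
    by rewrite DC// => -[].
have [B DB Bp] : (\bigcup_(B in D) B) p.
  apply: nonmeasurable_disjoint_closure => //.
  - by move=> B /DK[].
  - by move=> B /DK[].
  move=> C FC Cp.
  have [B GB BC] : exists2 B, G B & B `&` C !=set0.
    apply: contrapT => nGC; suff : (S `&` C) p by rewrite Smin// => B GB;
      apply: contrapT => /eqP/set0P BC; apply: nGC; exists B.
    by [].
  have [|B' DB' [x [B'x [Bx Cx]]]] := meetD (B `&` C).
    split=> //; first by apply: (field_of_setsI FF) => //; exact: GF.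
    by exists B => // x [].
  by exists B' => //; exists x.
by have [_ _ [B' GB' BB']] := DK _ DB; exists B' => //; exact: BB'.
Qed.

End SelfInjective.

(** * Fields of sets closed under arbitrary unions *)

Section CompleteField.
Set Implicit Arguments.
Unset Strict Implicit.
Import GRing.Theory numFieldNormedType.Exports.
Local Open Scope ring_scope.
Context {R : realType} {X : Type} {F : set (set X)}.
Context (FF : field_of_sets F) (FM : measurable_fct_closed R F).
Hypothesis Fcup : bigcup_closed F.
Local Notation M := (Mring FF FM).

Definition atom (x : X) : set X := \bigcap_(B in [set B | F B /\ B x]) B.

Lemma atomxx x : atom x x. Proof. by move=> B []. Qed.

Lemma atom_field x : F (atom x).
Proof.
rewrite -[atom x]setCK; apply: (field_of_setsC FF).
have -> : ~` atom x = \bigcup_(B in [set B | F B /\ ~ B x]) B.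
  apply/seteqP; split=> y /=.
    move=> nxy; apply: contrapT => yB; apply: nxy => B [FB Bx].
    apply: contrapT => nBy; apply: yB; exists (~` B) => //; split.
      exact: (field_of_setsC FF).
    exact.
  move=> [B [FB nBx] By] xy.
  by apply: (xy (~` B)) By; split=> //; exact: (field_of_setsC FF).
by apply: Fcup => B [].
Qed.

(** If atom y were smaller than atom x, it would miss x, and its complement
    would be a member of F containing x but not y. *)
Lemma atom_eq x y : atom x y -> atom y = atom x.
Proof.
move=> xy; apply/seteqP; split=> z.
  by move=> yz B [FB Bx]; apply: yz; split=> //; exact: xy.
move=> xz; apply: contrapT => nyz.
have [yx|nyx] := pselect (atom y x).
  by apply: nyz => B [FB By]; apply: xz; split=> //; exact: yx.
have := xy (~` atom y) (conj (field_of_setsC FF (atom_field y)) nyx).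
by apply; exact: atomxx.
Qed.

(** A measurable f cannot separate points of an atom, because the preimage of
    the complement of a value is in F; conversely a function constant on atoms
    has unions of atoms as preimages. *)
Lemma measurable_fct_atomP (f : X -> R) :
  measurable_fct F f <-> forall x y, atom x y -> f y = f x.
Proof.
split=> [Mf x y xy|fatom U oU].
  apply: contrapT => /eqP fyx.
  suff : (f @^-1` [set t | t != f y]) y by rewrite /preimage /= eqxx.
  apply: xy; split; first by apply: Mf; exact: open_neq.
  by rewrite /preimage /= eq_sym.
have -> : f @^-1` U = \bigcup_(B in [set atom x | x in f @^-1` U]) B.
  apply/seteqP; split=> [x Ux|y [_ [x Ux <-]] xy].
    by exists (atom x); [exists x|exact: atomxx].
  by rewrite /preimage /= (fatom _ _ xy).
by apply: Fcup => _ [x _ <-]; exact: atom_field.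
Qed.

Definition atom_indic (x : X) : M :=
  MkMring (mem_set (measurable_fct_indic (R := R) FF (atom_field x)) :
    _ \in Mpred FF FM).

Definition Mcst (k : R) : M :=
  MkMring (mem_set (measurable_fct_cst FF k) : _ \in Mpred FF FM).

(** The indicator of an atom spans a copy of R, the factor of the ring at this
    atom. *)
Lemma atom_indic_mul (x : X) (u : M) :
  atom_indic x * u = Mcst (val u x) * atom_indic x.
Proof.
apply: val_inj; rewrite !MringM; apply/funext => y; rewrite !fctE /= indicE.
have [/set_mem xy|_] := boolP (y \in atom x); last by rewrite mul0r mulr0.
have /measurable_fct_atomP/(_ _ _ xy) -> := MringP u.
exact: mulrC.
Qed.

(** At x, the map f on I is the multiplication by h x, where h x is the value
    at x of the image of the indicator of the atom of x, if I contains it. If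
    not, every u in I vanishes at x, and so does f u. *)
Lemma bigcup_closed_self_injective : self_injective M.
Proof.
move=> I f.
have /boolp.choice[h hP] (x : X) : exists k : R,
    (forall e : ideal_type I, val e = atom_indic x -> k = val (f e : M) x) /\
    ((atom_indic x : M^o) \notin I -> k = 0).
  have [xI|xNI] := boolP ((atom_indic x : M^o) \in I).
    exists (val (f (Sub (atom_indic x : M^o) xI) : M) x); split=> // e ex.
    by congr (val (f _ : M) x); apply: val_inj; rewrite SubK.
  exists 0; split=> // e ex; move: xNI.
  by rewrite -ex (valP e).
have Mh : h \in Mpred FF FM.
  apply/mem_set/measurable_fct_atomP => x y xy.
  have exy : atom_indic y = atom_indic x.
    by apply: val_inj; rewrite /= (atom_eq xy).
  have [xI|xNI] := boolP ((atom_indic x : M^o) \in I); last first.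
    by rewrite (hP x).2// (hP y).2// exy.
  pose e : ideal_type I := Sub (atom_indic x : M^o) xI.
  have eE : val e = atom_indic x by exact: SubK.
  rewrite ((hP x).1 e eE) ((hP y).1 e); last by rewrite exy.
  by have /measurable_fct_atomP/(_ _ _ xy) := MringP (f e : M).
pose g (u : M^o) : M^o := (u : M) * (MkMring Mh : M).
have glin : linear g by move=> a u v; rewrite /g [LHS]mulrDl -mulrA.
pose gL := GRing.isLinear.Build _ _ _ _ g glin.
pose G : {linear M^o -> M^o} := HB.pack g gL.
exists G => u; apply: val_inj; apply/funext => x.
have e1 (w : M) : val (atom_indic x * w : M) x = val w x.
  by rewrite MringM fctE /= indicE mem_set ?mul1r//; exact: atomxx.
have -> : val (G (val u)) x = val (val u : M) x * h x.
  by rewrite [G _]/((val u : M) * MkMring Mh : M) MringM fctE.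
(* Localise at the atom of x by multiplying by its indicator, which commutes
   with f. *)
rewrite -[RHS]e1.
have -> : atom_indic x * (f u : M) = f ((atom_indic x : M) *: u) :> M.
  by rewrite linearZZ.
have uE : val ((atom_indic x : M) *: u) =
    Mcst (val (val u : M) x) * atom_indic x :> M.
  by rewrite [LHS]ideal_valZ; exact: atom_indic_mul.
have [xI|xNI] := boolP ((atom_indic x : M^o) \in I).
  pose e : ideal_type I := Sub (atom_indic x : M^o) xI.
  have eE : val e = atom_indic x by exact: SubK.
  have -> : (atom_indic x : M) *: u = Mcst (val (val u : M) x) *: e.
    by apply: val_inj; rewrite uE [RHS]ideal_valZ eE.
  rewrite linearZZ ((hP x).1 e eE).
  by rewrite [_ *: f e]/(Mcst _ * (f e : M)) MringM fctE.
have ux0 : val (val u : M) x = 0.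
  apply: contraNeq xNI => ux0.
  have -> : (atom_indic x : M^o) =
      val (Mcst (val (val u : M) x)^-1 *: ((atom_indic x : M) *: u)).
    rewrite [RHS]ideal_valZ uE mulrA.
    apply: val_inj; rewrite !MringM; apply/funext => y.
    by rewrite !fctE /= mulVf// mul1r.
  exact: valP.
have -> : (atom_indic x : M) *: u = 0.
  apply: val_inj; rewrite uE ux0; apply: val_inj; rewrite MringM.
  by apply/funext => y; rewrite fctE /= mul0r.
by rewrite linear0 ux0 mul0r.
Qed.

End CompleteField.

Theorem theorem3p14 (R : realType) (X : Type) (A : set (set X))
    (X_nonempty : [set: X] !=set0)
    (X_nonmeasurable : nonmeasurable_cardinal X)
    (A_field : field_of_sets A)
    (M_closed : measurable_fct_closed R A) :
  self_injective (Mring A_field M_closed) <-> bigcup_closed A.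
Proof.
split; first by move=> inj; exact: self_injective_bigcup_closed inj _.
exact: bigcup_closed_self_injective.
Qed.
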